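(* Let $K\in\mathcal{K}$, i.e., $A-BK$ is Hurwitz and $\|\mathcal{T}(K)\|_\infty<\gamma$, with $\|K\|<\infty$. Let $K'$ be obtained from $K$ by one step, with stepsize $\eta>0$, of either (a) the natural policy gradient update $K'=K-2\eta(RK-B^\top P_K)$, with $\eta\le\dfrac{1}{2\|R\|}$, or (b) the Gauss–Newton update $K'=K-2\eta(K-R^{-1}B^\top P_K)$, with $\eta\le\dfrac12$. Then $K'\in\mathcal{K}$. Equivalently, $A-BK'$ is Hurwitz, and the Riccati equation $$(A-BK')^\top P_{K'}+P_{K'}(A-BK')+C^\top C+K'^\top RK'+\gamma^{-2}P_{K'}DD^\top P_{K'}=0$$ admits a stabilizing solution $P_{K'}\ge0$, i.e., one such that $A-BK'+\gamma^{-2}DD^\top P_{K'}$ is Hurwitz.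
   Context: Setting (continuous-time mixed $\mathcal{H}_2/\mathcal{H}_\infty$ design). $A\in\mathbb{R}^{m\times m}$, $B\in\mathbb{R}^{m\times d}$, $C\in\mathbb{R}^{l\times m}$, $D\in\mathbb{R}^{m\times n}$, $E\in\mathbb{R}^{l\times d}$ are real matrices satisfying $E^\top[C\ \ E]=[0\ \ R]$ for some $R>0$, and $\gamma>0$. Gains are $K\in\mathbb{R}^{d\times m}$. $\|\cdot\|$ is the operator norm; $X>0$ ($X\ge0$) denotes (symmetric) positive definite (semidefinite). A matrix is Hurwitz if all its eigenvalues have negative real part. Transfer function: $\mathcal{T}(K)(s)=(C^\top C+K^\top RK)^{1/2}(sI-(A-BK))^{-1}D$, with $\|\mathcal{T}(K)\|_\infty=\sup_{\omega\in\mathbb{R}}\sigma_{\max}[\mathcal{T}(K)(j\omega)]$. Feasible set: $\mathcal{K}=\{K: A-BK\text{ is Hurwitz},\ \|\mathcal{T}(K)\|_\infty<\gamma\}$. For $K\in\mathcal{K}$, $P_K\ge0$ denotes the unique stabilizing solution (it exists by the continuous-time Bounded Real Lemma) of $(A-BK)^\top P_K+P_K(A-BK)+C^\top C+K^\top RK+\gamma^{-2}P_KDD^\top P_K=0$, i.e., the unique solution with $A-BK+\gamma^{-2}DD^\top P_K$ Hurwitz. *)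

(* Defs.v *)
From HB Require Import structures.
From mathcomp Require Import all_boot all_order all_algebra.
From mathcomp Require Import all_classical all_reals ereal.
From mathcomp Require Import complex.

Set Implicit Arguments.
Unset Strict Implicit.
Unset Printing Implicit Defensive.

Import Order.TTheory GRing.Theory Num.Theory.

Local Open Scope classical_set_scope.
Local Open Scope ring_scope.
Local Open Scope complex_scope.
Local Open Scope sesquilinear_scope.

Section MatrixNotions.
Variable F : realType.

Definition psdmx n (X : 'M[F]_n) : Prop :=
  X^T = X /\ forall v : 'cV[F]_n, 0 <= (v^T *m X *m v) 0 0.

Definition pdmx n (X : 'M[F]_n) : Prop :=
  X^T = X /\ forall v : 'cV[F]_n, v != 0 -> 0 < (v^T *m X *m v) 0 0.

Definition cplxmx p q (M : 'M[F]_(p, q)) : 'M[F[i]]_(p, q) :=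
  map_mx (real_complex F) M.

Definition hurwitz n (X : 'M[F]_n) : Prop :=
  forall z : F[i], eigenvalue (cplxmx X) z -> complex.Re z < 0.

(* The positive semidefinite square root, which exists and is unique when X is
   positive semidefinite; for other X the value may be the default 0. *)
Definition psd_sqrt n (X : 'M[F]_n) : 'M[F]_n :=
  xget 0 [set S : 'M[F]_n | psdmx S /\ S *m S = X].

(* The singular values of M are the nonnegative s such that s ^+ 2 is an
   eigenvalue of M^* M. They form a finite set, so sup is the largest one
   (and sup set0 = 0 when M has no column). *)
Definition sigma_max p q (M : 'M[F[i]]_(p, q)) : F :=
  sup [set s : F | 0 <= s /\ eigenvalue (M ^t* *m M) (s ^+ 2)%:C].

Definition norm2 n (v : 'cV[F]_n) : F := Num.sqrt (\sum_i v i 0 ^+ 2).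

(* The norm induced by norm2; the library's `|M| on matrices is instead the
   largest absolute value of an entry. *)
Definition opnorm p q (M : 'M[F]_(p, q)) : F :=
  sup [set norm2 (M *m v) | v in [set v : 'cV[F]_q | norm2 v <= 1]].

End MatrixNotions.

Section MixedDesign.
Variables (F : realType) (m d l n : nat).
Variables (A : 'M[F]_m) (B : 'M[F]_(m, d)) (C : 'M[F]_(l, m)).
Variables (D : 'M[F]_(m, n)) (R : 'M[F]_d) (gamma : F).
Implicit Types (K : 'M[F]_(d, m)) (P : 'M[F]_m).

Definition transfer K (s : F[i]) : 'M[F[i]]_(m, n) :=
  cplxmx (psd_sqrt (C^T *m C + K^T *m R *m K)) *m
  invmx (s%:M - cplxmx (A - B *m K)) *m cplxmx D.

(* Extended real valued: the supremum is not assumed finite. *)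
Definition hinf_norm K : \bar F :=
  ereal_sup [set (sigma_max (transfer K (0 +i* w)))%:E | w in [set: F]].

Definition feasible K : Prop :=
  hurwitz (A - B *m K) /\ (hinf_norm K < gamma%:E)%E.

Definition stabilizing_solution K P : Prop :=
  [/\ psdmx P,
      (A - B *m K)^T *m P + P *m (A - B *m K) + C^T *m C + K^T *m R *m K
        + gamma ^- 2 *: (P *m D *m D^T *m P) = 0
    & hurwitz (A - B *m K + gamma ^- 2 *: (D *m D^T *m P))].

End MixedDesign.

(* Main.v *)
Require Import Defs.
From HB Require Import structures.
From mathcomp Require Import all_boot all_order all_algebra.
From mathcomp Require Import all_classical all_reals.
From mathcomp Require Import ereal topology normedtype sequences.
From mathcomp Require Import complex ring lra.

(** Write [A' = A - B K'], [Q' = C^T C + K'^T R K'], [N = gamma^-1 D] and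
[ric X = A'^T X + X A' + Q' + X N N^T X].  Put [Delta = K' - K].  Completing
the square in the Riccati equation of [K] shows that the old solution [P] is a
strict supersolution of the new equation: both updates have the form
[R K - B^T P = - (2 eta)^-1 T Delta] with [T = 1] for the natural gradient and
[T = R] for Gauss-Newton, so that
[- ric P = Delta^T (eta^-1 T - R) Delta], and the step size bound makes this
at least [c Delta^T Delta] for some [c > 0] ([ric_step], [step_feasible]).

Everything else follows from this inequality together with the fact that
[A' + N N^T P + B Delta = A - B K + gamma^-2 D D^T P] is Hurwitz.

- If [X] is symmetric with [X <= P] and [ric X >= 0], then [A' + N N^T X] is
  Hurwitz ([subsolution_hurwitz]): along an eigenvector [v] with eigenvalue in
  the closed right half plane, the quadratic form of [ric P - ric X] has to
  vanish, hence [Delta v = 0] and [N^T (P - X) v = 0], and then [v] is an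
  eigenvector of the Hurwitz matrix above for the same eigenvalue.  The case
  [X = 0] says that [A'] is Hurwitz.
- Newton's method for [ric X = 0] started at [0] produces an increasing
  sequence of such [X] bounded by [P] ([newton_step]).  Its limit is a
  solution, and the first point applied to the limit says that it is
  stabilizing ([stabilizing_solution_exists]).
- For the frequency bound, [i w x = A' x + N u] gives
  [x^* Q' x = |u|^2 - |r|^2 + x^* (ric P) x] with [r = u - N^T P x], and
  [i w x = (A' + N N^T P + B Delta) x + N r - B Delta x].  The resolvent of a
  Hurwitz matrix is bounded on the imaginary axis, so [|r|^2 + |Delta x|^2]
  dominates a fixed multiple of [|u|^2]; hence the gain from [u] to
  [Q'^(1/2) x] stays below 1 uniformly in [w] ([strict_gain_bound]).

The facts used about a Hurwitz matrix (the resolvent bound and the sign of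
solutions of Lyapunov inequalities) come without integrals or compactness from
one statement: after a change of basis, the Hermitian part of the matrix is
negative definite ([hurwitz_dissipative]). *)

Set Implicit Arguments.
Unset Strict Implicit.
Unset Printing Implicit Defensive.

Import Order.TTheory GRing.Theory Num.Theory.
Import numFieldNormedType.Exports.

Local Open Scope ring_scope.

(** * Entries and transposes *)

Lemma addmxE (V : nmodType) p q (M N : 'M[V]_(p, q)) i j :
  (M + N) i j = M i j + N i j.
Proof. by rewrite mxE. Qed.

Lemma oppmxE (V : zmodType) p q (M : 'M[V]_(p, q)) i j : (- M) i j = - M i j.
Proof. by rewrite mxE. Qed.

Lemma scalemxE (V : pzRingType) p q a (M : 'M[V]_(p, q)) i j :
  (a *: M) i j = a * M i j.
Proof. by rewrite mxE. Qed.

Lemma mxtrD (V : nmodType) p q (M N : 'M[V]_(p, q)) : (M + N)^T = M^T + N^T.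
Proof. exact: raddfD. Qed.

Lemma mxtrB (V : zmodType) p q (M N : 'M[V]_(p, q)) : (M - N)^T = M^T - N^T.
Proof. exact: raddfB. Qed.

Lemma mxtrZ (V : pzRingType) p q a (M : 'M[V]_(p, q)) : (a *: M)^T = a *: M^T.
Proof. exact: linearZ. Qed.

(** * Complex vectors as a real inner product space *)

(** The real part of the Hermitian product, so that inequalities between
complex vectors become real linear arithmetic.  It is locked so that
arithmetic treats its values as atoms. *)
HB.lock Definition rdot (F : realType) n (u v : 'cV[complex F]_n) : F :=
  complex.Re ((map_mx Num.conj u^T *m v) 0 0).

Section RealInnerProduct.
Local Open Scope complex_scope.
Local Open Scope sesquilinear_scope.
Variable F : realType.
Local Notation C := F[i].

Lemma ReD (x y : C) : complex.Re (x + y) = complex.Re x + complex.Re y.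
Proof. by case: x y => [a b] [c d]. Qed.

Lemma ReN (x : C) : complex.Re (- x) = - complex.Re x.
Proof. by case: x. Qed.

Lemma Re_sum I (s : seq I) (f : I -> C) :
  complex.Re (\sum_(i <- s) f i) = \sum_(i <- s) complex.Re (f i).
Proof. by elim/big_rec2: _ => //= i x y _ <-; rewrite ReD. Qed.

Lemma ReZ (a : F) (x : C) : complex.Re (a%:C * x) = a * complex.Re x.
Proof. by case: x => b c /=; rewrite mul0r subr0. Qed.

Lemma Re_conj (x : C) : complex.Re (Num.conj x) = complex.Re x.
Proof. by case: x. Qed.

Lemma rdotE n (u v : 'cV[C]_n) :
  rdot u v = \sum_i complex.Re ((u i 0)^*%R * v i 0).
Proof.
by rewrite rdot.unlock mxE Re_sum; apply: eq_bigr => i _; rewrite !mxE.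
Qed.

Lemma rdotC n (u v : 'cV[C]_n) : rdot u v = rdot v u.
Proof.
rewrite !rdotE; apply: eq_bigr => i _.
by rewrite -Re_conj rmorphM /= conjCK mulrC.
Qed.

Lemma rdotDr n (u v w : 'cV[C]_n) : rdot u (v + w) = rdot u v + rdot u w.
Proof. by rewrite rdot.unlock mulmxDr mxE ReD. Qed.

Lemma rdotDl n (u v w : 'cV[C]_n) : rdot (u + v) w = rdot u w + rdot v w.
Proof. by rewrite rdotC rdotDr !(rdotC w). Qed.

Lemma rdotNr n (u v : 'cV[C]_n) : rdot u (- v) = - rdot u v.
Proof. by rewrite rdot.unlock mulmxN mxE ReN. Qed.

Lemma rdotNl n (u v : 'cV[C]_n) : rdot (- u) v = - rdot u v.
Proof. by rewrite rdotC rdotNr rdotC. Qed.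

Lemma rdot0r n (u : 'cV[C]_n) : rdot u 0 = 0.
Proof. by rewrite rdot.unlock mulmx0 mxE. Qed.

Lemma rdotZr n (a : F) (u v : 'cV[C]_n) : rdot u (a%:C *: v) = a * rdot u v.
Proof. by rewrite rdot.unlock -scalemxAr mxE ReZ. Qed.

Lemma rdotZl n (a : F) (u v : 'cV[C]_n) : rdot (a%:C *: u) v = a * rdot u v.
Proof. by rewrite rdotC rdotZr rdotC. Qed.

Lemma rdot_adj m n (u : 'cV[C]_m) (M : 'M[C]_(m, n)) (v : 'cV[C]_n) :
  rdot u (M *m v) = rdot (M ^t* *m u) v.
Proof. by rewrite rdot.unlock trmx_mul map_mxM trmxCK mulmxA. Qed.

Definition sqmod (z : C) : F := complex.Re z ^+ 2 + complex.Im z ^+ 2.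

Lemma sqmod_ge0 z : 0 <= sqmod z.
Proof. by rewrite addr_ge0 ?sqr_ge0. Qed.

Definition sqn n (u : 'cV[C]_n) : F := rdot u u.

Lemma sqnE n (u : 'cV[C]_n) :
  sqn u = \sum_i sqmod (u i 0).
Proof.
rewrite /sqn rdotE /sqmod; apply: eq_bigr => i _.
by case: (u i 0) => a b /=; rewrite mulNr opprK !expr2.
Qed.

Lemma sqn_ge0 n (u : 'cV[C]_n) : 0 <= sqn u.
Proof. by rewrite sqnE sumr_ge0 // => i _; exact: sqmod_ge0. Qed.

Lemma sqn_eq0 n (u : 'cV[C]_n) : (sqn u == 0) = (u == 0).
Proof.
apply/eqP/eqP => [|->]; last by rewrite /sqn rdot0r.
rewrite sqnE => /eqP; rewrite psumr_eq0; last first.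
  by move=> i _; exact: sqmod_ge0.
move=> /allP h; apply/colP => i; rewrite mxE.
have := h i (mem_index_enum i).
rewrite /sqmod paddr_eq0 ?sqr_ge0 // !sqrf_eq0.
by case: (u i 0) => a b /= /andP[/eqP -> /eqP ->].
Qed.

Lemma sqn_gt0 n (u : 'cV[C]_n) : (0 < sqn u) = (u != 0).
Proof. by rewrite lt_neqAle sqn_ge0 andbT eq_sym sqn_eq0. Qed.

Lemma sqn0 n : sqn (0 : 'cV[C]_n) = 0.
Proof. by rewrite /sqn rdot0r. Qed.

(** Expand [0 <= |e u - v|^2] and divide by [e]. *)
Lemma rdot_young n (e : F) (u v : 'cV[C]_n) : 0 < e ->
  2 * rdot u v <= e * sqn u + e^-1 * sqn v.
Proof.
move=> e0; have := sqn_ge0 (e%:C *: u - v).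
rewrite /sqn rdotDl !rdotDr !(rdotNl, rdotNr, rdotZl, rdotZr) (rdotC v u) => h.
rewrite -(ler_pM2l e0) mulrDr !mulrA divff ?gt_eqF //; lra.
Qed.

Lemma sqnD n (u v : 'cV[C]_n) : sqn (u + v) <= 2 * sqn u + 2 * sqn v.
Proof.
have := @rdot_young _ 1 u v ltr01; rewrite invr1.
rewrite {3}/sqn rdotDl !rdotDr (rdotC v u) -!/(sqn _); lra.
Qed.

Lemma sqnN n (u : 'cV[C]_n) : sqn (- u) = sqn u.
Proof. by rewrite /sqn rdotNl rdotNr opprK. Qed.

(** Any bound, optimal or not, is enough below; column-by-column induction
avoids a Cauchy-Schwarz argument. *)
Lemma sqn_mulmx_bounded m n (M : 'M[C]_(m, n)) :
  exists2 c : F, 0 < c & forall v, sqn (M *m v) <= c * sqn v.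
Proof.
elim: n M => [|n IH].
  by move=> M; exists 1 => // v; rewrite thinmx0 mul0mx sqn0 mul1r sqn_ge0.
rewrite -[n.+1]/(1 + n)%N => M.
have [c c0 hc] := IH (rsubmx M).
pose k := sqn (lsubmx M).
have k0 : 0 <= k by exact: sqn_ge0.
exists (2 * k + 2 * c) => [|v]; first lra.
pose x := usubmx v; pose y := dsubmx v.
have -> : M *m v = lsubmx M *m x + rsubmx M *m y.
  by rewrite -mul_row_col hsubmxK vsubmxK.
have -> : sqn v = sqn x + sqn y.
  rewrite -(vsubmxK v) !sqnE big_split_ord /=; congr (_ + _);
    apply: eq_bigr => i _.
    by rewrite col_mxEu.
  by rewrite col_mxEd.
have kx : sqn (lsubmx M *m x) = k * sqn x.
  have -> : lsubmx M *m x = x 0 0 *: lsubmx M.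
    by apply/colP => i; rewrite mxE big_ord1 [RHS]mxE mulrC.
  rewrite [sqn x]sqnE big_ord1 /k !sqnE mulr_suml.
  apply: eq_bigr => i _; rewrite mxE /sqmod.
  by case: (x 0 0) (lsubmx M i 0) => p q [r s] /=; ring.
have := sqnD (lsubmx M *m x) (rsubmx M *m y); have := hc y.
rewrite kx; have := mulr_ge0 k0 (sqn_ge0 y).
have := mulr_ge0 (ltW c0) (sqn_ge0 x); lra.
Qed.

End RealInnerProduct.

(** * Hurwitz matrices are dissipative in a suitable basis *)

Section Dissipative.
Local Open Scope complex_scope.
Local Open Scope sesquilinear_scope.
Variable F : realType.
Local Notation C := F[i].

(** [eigenvalue] is defined with row vectors, while the dynamics act on
columns; a matrix and its transpose have the same eigenvalues. *)
Lemma eigenvalue_colP n (X : 'M[C]_n) z :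
  reflect (exists2 v : 'cV_n, v != 0 & X *m v = z *: v) (eigenvalue X z).
Proof.
have detE (Y : 'M[C]_n) : eigenvalue Y z <-> \det (Y - z%:M) = 0.
  split=> [/eigenvalueP[v vY v0]|/eqP/det0P[v v0 vY]].
    apply/eqP/det0P; exists v => //.
    by rewrite mulmxBr vY mul_mx_scalar subrr.
  apply/eigenvalueP; exists v => //.
  by apply/eqP; rewrite -subr_eq0 -mul_mx_scalar -mulmxBr vY.
apply: (equivP idP); rewrite detE -det_tr linearB /= tr_scalar_mx -detE.
split=> [/eigenvalueP[v vX v0]|[v v0 vX]].
  exists v^T; first by rewrite trmx_eq0.
  by rewrite -[X]trmxK -trmx_mul vX linearZ.
apply/eigenvalueP; exists v^T; last by rewrite trmx_eq0.
by rewrite -trmx_mul vX linearZ.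
Qed.

(** One off-diagonal term of the form [x^* T x] after scaling: [s] is the
scaling factor and [tau] the entry, and [2 |x| |tau y| <= |x|^2 + |tau y|^2]. *)
Lemma off_diagonal_bound (s t b : F) (tau x y : C) :
  0 <= s -> s <= t -> sqmod tau <= b ->
  complex.Re (x^*%R * (s%:C * tau * y)) <=
    t * (1 + b) / 2 * (sqmod x + sqmod y).
Proof.
move=> s0 st tb.
set r := complex.Re (x^*%R * (tau * y)).
have -> : complex.Re (x^*%R * (s%:C * tau * y)) = s * r.
  by rewrite -ReZ; congr complex.Re; ring.
have hr : 2 * r <= sqmod x + sqmod tau * sqmod y.
  rewrite /r /sqmod; case: x y tau {tb r} => p q [u v] [a c] /=.
  rewrite -subr_ge0.
  have := sqr_ge0 (p - (a * u - c * v)); have := sqr_ge0 (q - (a * v + c * u)).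
  by move=> h1 h2; apply: le_trans (addr_ge0 h1 h2) _; lra.
have hx := sqmod_ge0 x; have hy := sqmod_ge0 y; have ht := sqmod_ge0 tau.
have h1 : sqmod tau * sqmod y <= b * sqmod y by rewrite ler_wpM2r.
have b0 : 0 <= b by exact: le_trans tb.
have hb := mulr_ge0 b0 hx.
have h2 : r <= (1 + b) / 2 * (sqmod x + sqmod y) by lra.
set q := _ * (sqmod x + _) in h2.
have -> : t * (1 + b) / 2 * (sqmod x + sqmod y) = t * q by rewrite /q; ring.
apply: (@le_trans _ _ (s * q)); first by rewrite ler_wpM2l.
by rewrite ler_wpM2r // /q; apply: mulr_ge0; lra.
Qed.

(** Conjugating a lower triangular matrix by [diag (1, t, t^2, ...)] multiplies
the entry [(i, j)] by [t ^ (i - j)], so a small [t] makes the part below the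
diagonal negligible compared with the diagonal. *)
Lemma trig_dissipative n (T : 'M[C]_n) (d : F) : 0 < d -> is_trig_mx T ->
  (forall i, complex.Re (T i i) <= - d) ->
  exists S S' : 'M[C]_n, S *m S' = 1%:M /\
    forall v, rdot v (S *m T *m S' *m v) <= - (d / 2) * sqn v.
Proof.
move=> d0 /is_trig_mxP Ttrig Td.
pose b := \sum_(i < n) \sum_(j < n) sqmod (T i j).
have b0 : 0 <= b.
  by rewrite !sumr_ge0 // => i _; rewrite sumr_ge0 // => j _; exact: sqmod_ge0.
have hb i j : sqmod (T i j) <= b.
  rewrite /b (bigD1 i) //= (bigD1 j) //= -addrA ler_wpDr // addr_ge0 //.
    by rewrite sumr_ge0 // => k _; exact: sqmod_ge0.
  by rewrite sumr_ge0 // => k _; rewrite sumr_ge0 // => l _; exact: sqmod_ge0.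
have n0 : 0 <= n%:R :> F by exact: ler0n.
(* The scaling [t = d / e] is at most 1 and makes the sum of all
   off-diagonal bounds at most [d / 2] times [|v|^2]. *)
pose e := d + 2 * (1 + b) * n%:R.
have bn : 0 <= (1 + b) * n%:R by rewrite mulr_ge0 // addr_ge0.
have e0 : 0 < e by rewrite /e -mulrA; lra.
pose t := d / e.
have t0 : 0 < t by exact: divr_gt0.
have t1 : t <= 1 by rewrite ler_pdivrMr // /e -mulrA; lra.
have tn : t * (1 + b) * n%:R <= d / 2.
  have te : t * e = d by rewrite divfK // gt_eqF.
  have td : 0 <= t * d by rewrite mulr_ge0 ?ltW.
  by rewrite /e in te; lra.
have tb0 : 0 <= t * (1 + b) / 2.
  by apply: mulr_ge0; [apply: mulr_ge0; lra | lra].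
exists (diag_mx (\row_(i < n) (t ^+ i)%:C)).
exists (diag_mx (\row_(i < n) (t ^- i)%:C)).
split.
  rewrite mulmx_diag -diag_const_mx; congr diag_mx.
  apply/rowP => i; rewrite !mxE -rmorphM /= divff ?expf_neq0 ?gt_eqF //.
move=> v; rewrite mul_diag_mx mul_mx_diag.
pose a i := sqmod (v i 0).
have sqa : sqn v = \sum_i a i by rewrite sqnE.
have a0 i : 0 <= a i by exact: sqmod_ge0.
rewrite rdotE.
apply: (@le_trans _ _
    (\sum_i (- d * a i + \sum_j t * (1 + b) / 2 * (a i + a j)))).
  apply: ler_sum => i _.
  rewrite mxE mulr_sumr Re_sum (bigD1 i) //= [X in _ <= _ + X](bigD1 i) //=.
  rewrite addrA; apply: lerD.
    rewrite !mxE.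
    have -> : (v i 0)^*%R * ((t ^+ i)%:C * T i i * (t ^- i)%:C * v i 0) =
       ((v i 0)^*%R * (T i i * v i 0)).
      have hti : (t ^+ i)%:C * (t ^- i)%:C = 1 :> C.
        by rewrite -rmorphM /= divff ?expf_neq0 ?gt_eqF.
      rewrite -[RHS]mul1r -hti; ring.
    apply: (@le_trans _ _ (- d * a i)); last first.
      by rewrite lerDl mulr_ge0 // addr_ge0.
    apply: (@le_trans _ _ (complex.Re (T i i) * a i)); last by rewrite ler_wpM2r.
    by rewrite /a /sqmod; case: (T i i) (v i 0) => p q [r s] /=; lra.
  apply: ler_sum => j ji; rewrite !mxE.
  have [lt_ij|lt_ji|/val_inj eij] := ltngtP i j.
  - rewrite Ttrig // mulr0 !mul0r mulr0 /=.
    by rewrite mulr_ge0 // addr_ge0.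
  - have -> : (t ^+ i)%:C * T i j * (t ^- j)%:C * v j 0
       = (t ^+ (i - j))%:C * T i j * v j 0.
      have -> : t ^+ (i - j) = t ^+ i * t ^- j.
        by rewrite -{2}(subnK (ltnW lt_ji)) exprD mulfK // expf_neq0 ?gt_eqF.
      rewrite [(_ * t ^- j)%:C]rmorphM /=; ring.
    apply: off_diagonal_bound => //; first by rewrite exprn_ge0 ?ltW.
    rewrite -[leRHS]expr1; apply: ler_wiXn2l => //; first exact: ltW.
    by rewrite subn_gt0.
  - by rewrite eij eqxx in ji.
rewrite big_split /= -mulr_sumr -sqa.
under eq_bigr do
  rewrite -mulr_sumr big_split /= sumr_const card_ord -sqa.
rewrite -mulr_sumr big_split /= sumrMnl -sqa sumr_const card_ord.
rewrite -[sqn v *+ n]mulr_natr.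
have := ler_wpM2r (sqn_ge0 v) tn; lra.
Qed.

(** The substitute for a Lyapunov function: in the basis given by [S] the
squared norm decreases along the flow of [X].  Schur triangularization reduces
to [trig_dissipative]. *)
Lemma hurwitz_dissipative n (X : 'M[C]_n) :
  (forall z, eigenvalue X z -> complex.Re z < 0) ->
  exists S S' : 'M[C]_n, S *m S' = 1%:M /\
  exists2 d : F, 0 < d & forall v, rdot v (S *m X *m S' *m v) <= - d * sqn v.
Proof.
case: n X => [|n] X hX.
  exists 1%:M, 1%:M; split; first by rewrite mulmx1.
  by exists 1 => // v; rewrite [v]flatmx0 sqn0 mulmx0 rdot0r mulr0.
have [P Pu /=] := Schur X (ltn0Sn n).
rewrite /similar_to conjymx // => Ttrig.
set T := P *m X *m _ in Ttrig.
have PP : P *m P ^t* = 1%:M by apply/unitarymxP.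
have PP' : P ^t* *m P = 1%:M by exact: mulmx1C.
have Tneg i : complex.Re (T i i) < 0.
  apply: hX.
  have /eigenvalue_colP[v v0 Tv] : eigenvalue T (T i i).
    rewrite eigenvalue_root_char char_poly_trig // /root horner_prod.
    by rewrite (bigD1 i) //= !hornerE subrr mul0r.
  apply/eigenvalue_colP; exists (P ^t* *m v).
    apply: contraNneq v0 => Pv0.
    by rewrite -[v]mul1mx -PP -mulmxA Pv0 mulmx0.
  rewrite scalemxAr -Tv /T !mulmxA PP' mul1mx //.
pose d := \big[Order.min/1]_i (- complex.Re (T i i)).
have d0 : 0 < d by apply: lt_bigmin => // i _; rewrite oppr_gt0.
have Td i : complex.Re (T i i) <= - d.
  by rewrite lerNr; exact: bigmin_le.
have [S [S' [SS' hS]]] := trig_dissipative d0 Ttrig Td.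
exists (S *m P), (P ^t* *m S'); split.
  by rewrite mulmxA -(mulmxA S) PP mulmx1.
exists (d / 2); first lra.
by move=> v; have := hS v; rewrite /T !mulmxA.
Qed.

End Dissipative.

(** * Lyapunov inequalities and quadratic forms of real matrices *)

Section HurwitzForms.
Local Open Scope complex_scope.
Local Open Scope sesquilinear_scope.
Variable F : realType.
Local Notation C := F[i].

Lemma conj_complexE (a b : F) : (a +i* b)^*%R = a +i* (- b).
Proof. by []. Qed.

Lemma rdot_scale n (u v : 'cV[C]_n) (a : C) :
  rdot u (a *: v) = rdot (a^*%R *: u) v.
Proof.
by rewrite rdot.unlock -scalemxAr linearZ /= map_mxZ /= conjCK -scalemxAl.
Qed.

(** [u^* H u] is real, so multiplying it by [i w] leaves no real part. *)
Lemma rdot_imag n (H : 'M[C]_n) (w : F) (u : 'cV[C]_n) : H ^t* = H ->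
  rdot (H *m u) ((0 +i* w) *: u) = 0.
Proof.
move=> Hadj.
have E : rdot (H *m u) ((0 +i* w) *: u) = - rdot (H *m u) ((0 +i* w) *: u).
  rewrite {1}rdot_scale.
  have -> : (0 +i* w)^*%R = - (0 +i* w) :> C.
    by rewrite conj_complexE; apply/eqP; rewrite eq_complex /= oppr0 !eqxx.
  by rewrite scaleNr rdotNl scalemxAr rdotC rdot_adj Hadj.
lra.
Qed.

(** In the dissipative basis [Z] becomes a Hermitian matrix [W]; on an
eigenvector of [W] the hypothesis reads [mu * (negative number) <= 0], so every
eigenvalue [mu] of [W] is nonnegative. *)
Lemma lyapunov_ge0 n (X Z : 'M[C]_n) :
  (forall z, eigenvalue X z -> complex.Re z < 0) -> Z ^t* = Z ->
  (forall v, rdot (Z *m v) (X *m v) <= 0) -> forall v, 0 <= rdot v (Z *m v).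
Proof.
move=> hX Zadj hZ v.
have [S [S' [SS' [d d0 hd]]]] := hurwitz_dissipative hX.
have S'S : S' *m S = 1%:M by exact: mulmx1C.
have adjSS : S ^t* *m S' ^t* = 1%:M.
  by rewrite -map_mxM -trmx_mul S'S trmx1 map_mx1.
pose W := S' ^t* *m Z *m S'.
have Wadj : W ^t* = W by rewrite /W !trmx_mul !map_mxM trmxCK Zadj mulmxA.
have Wherm : W \is hermsymmx.
  by apply/is_hermitianmxP; rewrite expr0 scale1r Wadj.
have /orthomx_spectralP := hermitian_normalmx Wherm.
have Uu := spectral_unitarymx W.
have Mr := hermitian_spectral_diag_real Wherm.
set U := spectralmx W in Uu *; set mu := spectral_diag W in Mr *.
rewrite (invmx_unitary Uu) => WE.
have UU : U *m U ^t* = 1%:M by apply/unitarymxP.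
have ZE : Z = S ^t* *m W *m S.
  by rewrite /W !mulmxA adjSS mul1mx -mulmxA S'S mulmx1.
clearbody W.
have mu_ge0 i : exists2 k : F, 0 <= k & mu 0 i = k%:C.
  have /complex_realP[k kE] := mxOverP Mr 0 i.
  exists k => //.
  pose e : 'cV[C]_n := U ^t* *m delta_mx i 0.
  have We : W *m e = k%:C *: e.
    rewrite /e {1}WE -!mulmxA (mulmxA U) UU mul1mx scalemxAr; congr (_ *m _).
    apply/matrixP => a b; rewrite mul_diag_mx !mxE.
    by case: eqP => [->|]; rewrite ?kE //= !mulr0.
  have e0 : 0 < sqn e.
    rewrite sqn_gt0; apply/eqP => /(congr1 (mulmx U)).
    rewrite /e mulmxA UU mul1mx mulmx0 => /matrixP/(_ i 0)/eqP.
    by rewrite !mxE !eqxx oner_eq0.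
  clearbody e.
  have := hZ (S' *m e); rewrite {1}ZE -!mulmxA (mulmxA S) SS' mul1mx We.
  rewrite -scalemxAr rdotZl -rdot_adj !mulmxA => h.
  rewrite leNgt; apply/negP => k0.
  have := hd e.
  have : - d * sqn e < 0 by rewrite mulNr oppr_lt0 mulr_gt0.
  move=> h1 h2; have := le_lt_trans h2 h1.
  by rewrite nmulr_rle0 // in h; rewrite ltNge h.
rewrite ZE WE -!mulmxA rdot_adj trmxCK rdot_adj trmxCK.
move: (U *m (S *m v)) => y.
rewrite rdotE sumr_ge0 // => i _; rewrite mul_diag_mx mxE.
have [k k0 ->] := mu_ge0 i; rewrite mulrCA ReZ mulr_ge0 //.
by case: (y i 0) => p q /=; rewrite mulNr opprK addr_ge0 // -expr2 sqr_ge0.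
Qed.

(** Taking the product with [y = S x] in the dissipative basis, the term
[i w |y|^2] has no real part, which leaves [d |y|^2 <= rdot y (S f)] whatever
[w] is. *)
Lemma resolvent_bound n (X : 'M[C]_n) :
  (forall z, eigenvalue X z -> complex.Re z < 0) ->
  exists2 c : F, 0 < c & forall w x f,
    (0 +i* w) *: x = X *m x + f -> sqn x <= c * sqn f.
Proof.
move=> /hurwitz_dissipative [S [S' [SS' [d d0 hd]]]].
have S'S : S' *m S = 1%:M by exact: mulmx1C.
have [a a0 ha] := sqn_mulmx_bounded S'; have [b b0 hb] := sqn_mulmx_bounded S.
exists (a * (d^-1 * (d^-1 * b))) => [|w x f E].
  by rewrite !mulr_gt0 ?invr_gt0.
pose y := S *m x.
have xE : x = S' *m y by rewrite /y mulmxA S'S mul1mx.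
have yE : (0 +i* w) *: y = S *m X *m S' *m y + S *m f.
  by rewrite /y scalemxAr E mulmxDr !mulmxA -(mulmxA _ S' S) S'S mulmx1.
have := @rdot_imag _ 1%:M w y _; rewrite trmx1 map_mx1 => /(_ erefl).
rewrite mul1mx yE rdotDr => h0.
have h1 := hd y; have := rdot_young y (S *m f) d0 => h2.
have h3 : d * sqn y <= d^-1 * sqn (S *m f) by lra.
have h4 : sqn y <= d^-1 * (d^-1 * (b * sqn f)).
  rewrite -(ler_pM2l d0) mulVKf ?gt_eqF //.
  by apply: le_trans h3 _; rewrite ler_wpM2l ?invr_ge0 ?hb // ltW.
rewrite {1}xE; apply: le_trans (ha y) _.
by rewrite -!mulrA ler_wpM2l // ltW.
Qed.

Lemma cplxmx_adj p q (M : 'M[F]_(p, q)) : (cplxmx M) ^t* = cplxmx M^T.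
Proof. by apply/matrixP => i j; rewrite !mxE conj_complexE oppr0. Qed.

Lemma cplxmxM p q r (M : 'M[F]_(p, q)) (N : 'M_(q, r)) :
  cplxmx (M *m N) = cplxmx M *m cplxmx N.
Proof. exact: map_mxM. Qed.

Lemma cplxmxD p q (M N : 'M[F]_(p, q)) : cplxmx (M + N) = cplxmx M + cplxmx N.
Proof. exact: map_mxD. Qed.

Lemma cplxmxN p q (M : 'M[F]_(p, q)) : cplxmx (- M) = - cplxmx M.
Proof. exact: map_mxN. Qed.

Lemma cplxmxZ p q a (M : 'M[F]_(p, q)) : cplxmx (a *: M) = a%:C *: cplxmx M.
Proof. exact: map_mxZ. Qed.

Lemma rdot_cplx n (a b : 'cV[F]_n) : rdot (cplxmx a) (cplxmx b) = (a^T *m b) 0 0.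
Proof. by rewrite rdot.unlock cplxmx_adj -cplxmxM mxE. Qed.

(** The real part of the Hermitian form of a real matrix at a complex vector,
needed because eigenvectors and frequency responses are complex. *)
Definition qf n (M : 'M[F]_n) (v : 'cV[C]_n) : F := rdot v (cplxmx M *m v).

(** For symmetric [M], the form at [a + i b] is the sum of the forms at [a] and
at [b]. *)
Lemma psdmx_qf n (M : 'M[F]_n) :
  psdmx M <-> M^T = M /\ forall v, 0 <= qf M v.
Proof.
split=> [[Msym hM]|[Msym hM]]; split=> // v; last first.
  by have := hM (cplxmx v); rewrite /qf -cplxmxM rdot_cplx mulmxA.
pose a : 'cV[F]_n := map_mx (@complex.Re F) v.
pose b : 'cV[F]_n := map_mx (@complex.Im F) v.
have -> : qf M v = (a^T *m M *m a) 0 0 + (b^T *m M *m b) 0 0.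
  have vE : v = cplxmx a + (0 +i* 1) *: cplxmx b.
    apply/matrixP => i j; rewrite !mxE; case: (v i j) => p q.
    apply/eqP; rewrite eq_complex /=.
    by rewrite !(mul0r, mul1r, subr0, addr0, add0r, mulr0) !eqxx.
  have rot u w : rdot ((0 +i* 1) *: u) ((0 +i* 1) *: w) = rdot u w :> F.
    rewrite rdot_scale scalerA; congr (rdot _ w).
    rewrite -[RHS]scale1r; congr (_ *: _).
    apply/eqP; rewrite conj_complexE eq_complex /=.
    by rewrite !(mul0r, mul1r, addr0, mulr0, sub0r, opprK, mulN1r) !eqxx.
  have cross p q : rdot (cplxmx p) ((0 +i* 1) *: cplxmx q) = 0 :> F.
    rewrite rdotE big1 // => i _; rewrite !mxE conj_complexE /=.
    by rewrite !(mul0r, mulr0, mul1r, subr0, addr0, oppr0).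
  rewrite /qf {1 2}vE mulmxDr -scalemxAr -!cplxmxM rdotDl !rdotDr rot !rdot_cplx.
  by rewrite cross (rdotC _ (cplxmx (M *m a))) cross addr0 add0r !mulmxA.
exact: addr_ge0.
Qed.

Lemma qfD n (M N : 'M[F]_n) v : qf (M + N) v = qf M v + qf N v.
Proof. by rewrite /qf cplxmxD mulmxDl rdotDr. Qed.

Lemma qfN n (M : 'M[F]_n) v : qf (- M) v = - qf M v.
Proof. by rewrite /qf cplxmxN mulNmx rdotNr. Qed.

Lemma qfZ n a (M : 'M[F]_n) v : qf (a *: M) v = a * qf M v.
Proof. by rewrite /qf cplxmxZ -scalemxAl rdotZr. Qed.

Lemma qf_gram m n (N : 'M[F]_(m, n)) v : qf (N^T *m N) v = sqn (cplxmx N *m v).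
Proof. by rewrite /qf cplxmxM -mulmxA rdot_adj cplxmx_adj trmxK. Qed.

Lemma qf_lyap n (A Z : 'M[F]_n) v : Z^T = Z ->
  qf (A^T *m Z + Z *m A) v = 2 * rdot (cplxmx Z *m v) (cplxmx A *m v).
Proof.
move=> Zs; rewrite qfD /qf !cplxmxM -!mulmxA rdot_adj cplxmx_adj trmxK.
rewrite [rdot v _]rdot_adj cplxmx_adj Zs rdotC; ring.
Qed.

Lemma lyapunov_psd n (A Z : 'M[F]_n) : hurwitz A -> Z^T = Z ->
  psdmx (- (A^T *m Z + Z *m A)) -> psdmx Z.
Proof.
move=> hA Zs /psdmx_qf[_ hL]; apply/psdmx_qf; split=> //.
apply: (lyapunov_ge0 hA); first by rewrite cplxmx_adj Zs.
by move=> v; have := hL v; rewrite qfN qf_lyap //; lra.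
Qed.

Lemma sym_polarization n (M : 'M[F]_n) i j : M^T = M ->
  let q (v : 'cV[F]_n) := (v^T *m M *m v) 0 0 in
  M i j = 2^-1 *
    (q (delta_mx i 0 + delta_mx j 0) - q (delta_mx i 0) - q (delta_mx j 0)).
Proof.
move=> Ms q.
have E a b :
    ((delta_mx a 0 : 'cV[F]_n)^T *m M *m (delta_mx b 0 : 'cV_n)) 0 0 = M a b.
  by rewrite trmx_delta -rowE -colE !mxE.
rewrite /q mxtrD mulmxDl mulmxDl !mulmxDr !addmxE !E.
have : M j i = M i j by rewrite -{1}Ms mxE.
lra.
Qed.

Lemma psdmx_antisym n (X : 'M[F]_n) : psdmx X -> psdmx (- X) -> X = 0.
Proof.
move=> [Xs X0] [_ X1].
have q0 (v : 'cV[F]_n) : (v^T *m X *m v) 0 0 = 0.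
  apply/eqP; rewrite eq_le X0 andbT.
  by have := X1 v; rewrite mulmxN mulNmx mxE oppr_ge0.
apply/matrixP => i j.
by rewrite mxE (sym_polarization _ _ Xs) !q0 !subr0 mulr0.
Qed.

Lemma qf1 n (a : F) (v : 'cV[C]_n) : qf a%:M v = a * sqn v.
Proof. by rewrite -scalemx1 qfZ /qf /cplxmx map_mx1 mul1mx. Qed.

Lemma psdmx0 n : psdmx (0 : 'M[F]_n).
Proof. by split=> [|v]; rewrite ?trmx0 // mulmx0 mul0mx mxE. Qed.

Lemma psdmxD n (X Y : 'M[F]_n) : psdmx X -> psdmx Y -> psdmx (X + Y).
Proof.
move=> /psdmx_qf[Xs X0] /psdmx_qf[Ys Y0]; apply/psdmx_qf.
by split=> [|v]; rewrite ?mxtrD ?Xs ?Ys // qfD addr_ge0.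
Qed.

Lemma psdmxZ n a (X : 'M[F]_n) : 0 <= a -> psdmx X -> psdmx (a *: X).
Proof.
move=> a0 /psdmx_qf[Xs X0]; apply/psdmx_qf.
by split=> [|v]; rewrite ?mxtrZ ?Xs // qfZ mulr_ge0.
Qed.

Lemma psdmx_congr p n (M : 'M[F]_(p, n)) (X : 'M[F]_p) :
  psdmx X -> psdmx (M^T *m X *m M).
Proof.
move=> /psdmx_qf[Xs X0]; apply/psdmx_qf; split=> [|v].
  by rewrite !trmx_mul trmxK Xs mulmxA.
rewrite /qf !cplxmxM -!mulmxA rdot_adj cplxmx_adj trmxK; exact: X0.
Qed.

Lemma psdmx_gram p n (M : 'M[F]_(p, n)) : psdmx (M^T *m M).
Proof.
apply/psdmx_qf; split=> [|v]; first by rewrite trmx_mul trmxK.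
by rewrite qf_gram sqn_ge0.
Qed.

End HurwitzForms.

(** * Solvability of the Lyapunov equation *)

Section Lyapunov.
Variables (F : realType) (n : nat) (A : 'M[F]_n).

(** Up to a factor 2, the Lyapunov operator on the symmetric part of [X] plus
the skew part of [X]: unlike for the Lyapunov operator itself, its injectivity
only involves symmetric matrices, to which [lyapunov_psd] applies. *)
Definition lyap_map (X : 'M[F]_n) : 'M[F]_n :=
  A^T *m (X + X^T) + (X + X^T) *m A + (X - X^T).

Lemma lyap_map_linear : linear lyap_map.
Proof.
move=> a X Y; rewrite /lyap_map linearP /=.
rewrite !(mulmxDl, mulmxDr, mulmxN, mulNmx) -!scalemxAl -!scalemxAr.
apply/matrixP => i j; rewrite !(addmxE, oppmxE, scalemxE); ring.
Qed.

HB.instance Definition _ :=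
  GRing.isLinear.Build F 'M[F]_n 'M[F]_n _ lyap_map lyap_map_linear.

Hypothesis hA : hurwitz A.

Lemma lyap_map_tr X : (lyap_map X)^T =
  A^T *m (X + X^T) + (X + X^T) *m A - (X - X^T).
Proof.
rewrite /lyap_map !linearD /= linearN /= !trmx_mul !trmxK !linearD /= trmxK.
rewrite !(mulmxDl, mulmxDr, mulmxN, mulNmx).
apply/matrixP => i j; rewrite !(addmxE, oppmxE, scalemxE); ring.
Qed.

(** The skew part of the image is twice the skew part of [X]; the symmetric
part of [X] is both nonnegative and nonpositive by [lyapunov_psd]. *)
Lemma lyap_map_inj X : lyap_map X = 0 -> X = 0.
Proof.
move=> X0; have := lyap_map_tr X; rewrite X0 trmx0 => X0'.
have skew0 : X - X^T = 0.
  apply/matrixP => i j; move: X0 X0' => /matrixP/(_ i j) + /matrixP/(_ i j).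
  rewrite /lyap_map !(addmxE, oppmxE) !mxE; lra.
have sym0 : A^T *m (X + X^T) + (X + X^T) *m A = 0.
  by move: X0; rewrite /lyap_map skew0 addr0.
have XXs : (X + X^T)^T = X + X^T by rewrite linearD /= trmxK addrC.
have XX0 : X + X^T = 0.
  apply: psdmx_antisym; apply: (lyapunov_psd hA) => //.
  - by rewrite sym0 oppr0; exact: psdmx0.
  - by rewrite linearN /= XXs.
  - by rewrite mulmxN mulNmx -opprD sym0 !oppr0; exact: psdmx0.
apply/matrixP => i j; move: skew0 XX0 => /matrixP/(_ i j) + /matrixP/(_ i j).
rewrite !(addmxE, oppmxE) !mxE; lra.
Qed.

Lemma lyapunov_solution Q : Q^T = Q ->
  exists2 X : 'M[F]_n, X^T = X & A^T *m X + X *m A = Q.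
Proof.
move=> Qs.
have Lu : lin_mx lyap_map \in unitmx.
  rewrite unitmxE unitfE; apply/negP => /det0P[v v0 vL].
  move/eqP: v0; apply.
  rewrite -[v]vec_mxK in vL *.
  rewrite mul_vec_lin in vL.
  by rewrite (lyap_map_inj (can_inj mxvecK (etrans vL _))) ?linear0.
pose X := vec_mx (mxvec Q *m invmx (lin_mx lyap_map)).
have XQ : lyap_map X = Q.
  by apply: (can_inj mxvecK); rewrite -mul_vec_lin vec_mxK mulmxKV.
have XQ' := lyap_map_tr X; rewrite XQ Qs in XQ'.
exists (X + X^T); first by rewrite linearD /= trmxK addrC.
apply/matrixP => i j; move: XQ XQ' => /matrixP/(_ i j) + /matrixP/(_ i j).
rewrite /lyap_map !(addmxE, oppmxE); lra.
Qed.

End Lyapunov.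

(** * Entrywise limits of matrices *)

Section MatrixLimits.
Local Open Scope classical_set_scope.
Variable F : realType.

(** Entrywise convergence, so that the limit theorems for real sequences apply
directly. *)
Definition mxcvg p q (X : nat -> 'M[F]_(p, q)) (L : 'M[F]_(p, q)) : Prop :=
  forall i j, X k i j @[k --> \oo] --> L i j.

Lemma mxcvg_cst p q (M : 'M[F]_(p, q)) : mxcvg (fun=> M) M.
Proof. by move=> i j; exact: cvg_cst. Qed.

Lemma mxcvgD p q (X Y : nat -> 'M[F]_(p, q)) L M :
  mxcvg X L -> mxcvg Y M -> mxcvg (fun k => X k + Y k) (L + M).
Proof.
move=> XL YM i j; rewrite addmxE; under eq_fun do rewrite addmxE.
exact: cvgD.
Qed.

Lemma mxcvgB p q (X Y : nat -> 'M[F]_(p, q)) L M :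
  mxcvg X L -> mxcvg Y M -> mxcvg (fun k => X k - Y k) (L - M).
Proof.
move=> XL YM i j; rewrite addmxE oppmxE; under eq_fun do rewrite addmxE oppmxE.
exact: cvgB.
Qed.

Lemma mxcvgM p q r (X : nat -> 'M[F]_(p, q)) (Y : nat -> 'M[F]_(q, r)) L M :
  mxcvg X L -> mxcvg Y M -> mxcvg (fun k => X k *m Y k) (L *m M).
Proof.
move=> XL YM i j; rewrite mxE; under eq_fun do rewrite mxE.
by apply: cvg_big => [|l _]; [exact: add_continuous | exact: cvgM].
Qed.

Lemma mxcvg_tr p q (X : nat -> 'M[F]_(p, q)) L :
  mxcvg X L -> mxcvg (fun k => (X k)^T) L^T.
Proof. by move=> XL i j; rewrite mxE; under eq_fun do rewrite mxE; exact: XL. Qed.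

Lemma mxcvg_unique p q (X : nat -> 'M[F]_(p, q)) L M :
  mxcvg X L -> mxcvg X M -> L = M.
Proof.
move=> XL XM; apply/matrixP => i j.
exact: (cvg_unique _ (XL i j) (XM i j)).
Qed.

Lemma mxcvg_psd n (X : nat -> 'M[F]_n) L :
  (forall k, psdmx (X k)) -> mxcvg X L -> psdmx L.
Proof.
move=> Xpsd XL; split=> [|v].
  apply: (mxcvg_unique (mxcvg_tr XL)).
  by under eq_fun do rewrite (Xpsd _).1.
have := mxcvgM (mxcvgM (mxcvg_cst (M := v^T)) XL) (mxcvg_cst (M := v)).
move=> /(_ 0 0) /cvgr_to_ge; apply.
by apply: nearW => k; exact: (Xpsd k).2.
Qed.

(** The quadratic forms of the [X k] at a fixed vector are increasing and
bounded, hence convergent, and entries are recovered by polarization. *)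
Lemma mxcvg_monotone n (X : nat -> 'M[F]_n) (P : 'M[F]_n) :
  (forall k, (X k)^T = X k) -> (forall k, psdmx (X k.+1 - X k)) ->
  (forall k, psdmx (P - X k)) -> exists L, mxcvg X L.
Proof.
move=> Xs Xmono XP.
pose q (v : 'cV[F]_n) (M : 'M[F]_n) := (v^T *m M *m v) 0 0.
have qB v M N : q v (M - N) = q v M - q v N.
  by rewrite /q mulmxBr mulmxBl addmxE oppmxE.
have qcvg v : cvgn (fun k => q v (X k)).
  apply: nondecreasing_is_cvgn.
    apply/nondecreasing_seqP => k.
    by rewrite -subr_ge0 -qB; exact: (Xmono k).2.
  exists (q v P) => _ [k _ <-].
  by rewrite -subr_ge0 -qB; exact: (XP k).2.
exists (\matrix_(i, j) (2^-1 *
    (limn (fun k => q (delta_mx i 0 + delta_mx j 0) (X k)) -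
     limn (fun k => q (delta_mx i 0) (X k)) -
     limn (fun k => q (delta_mx j 0) (X k))))) => i j.
rewrite mxE; under eq_fun do rewrite sym_polarization //.
apply: cvgM; first exact: cvg_cst.
by apply: cvgB; [apply: cvgB|]; exact: qcvg.
Qed.

End MatrixLimits.

(** * Riccati inequalities *)

Lemma squeeze0 (F : realFieldType) (a b e f : F) :
  0 <= a -> 0 <= b -> 0 <= e -> 0 <= f -> a <= - (e + 2 * f + b) ->
  a = 0 /\ b = 0.
Proof. by move=> *; split; lra. Qed.

Section Riccati.
Local Open Scope complex_scope.
Variables (F : realType) (n k p : nat).
Variables (A Q : 'M[F]_n) (N : 'M[F]_(n, k)).
Local Notation C := F[i].

Lemma rdot_selfadj_scale (H : 'M[F]_n) (z : C) (v : 'cV[C]_n) : H^T = H ->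
  rdot (cplxmx H *m v) (z *: v) = complex.Re z * qf H v.
Proof.
move=> Hs; have -> : z = (complex.Re z)%:C + (0 +i* complex.Im z).
  by case: z => a b; apply/eqP; rewrite eq_complex /= addr0 add0r !eqxx.
rewrite scalerDl rdotDr rdotZr rdot_imag; last by rewrite cplxmx_adj Hs.
by rewrite rdotC /= !addr0.
Qed.

Definition ric (X : 'M[F]_n) : 'M[F]_n :=
  A^T *m X + X *m A + Q + X *m N *m N^T *m X.

(** The closed-loop matrix under the worst disturbance [N^T X x]; it is also
the matrix of the Lyapunov operator obtained by linearizing [ric] at [X]. *)
Definition acl (X : 'M[F]_n) : 'M[F]_n := A + N *m N^T *m X.

(** The second-order term is nonnegative for symmetric [H]: this is the
convexity behind the comparison arguments below. *)
Lemma ric_taylor X H : X^T = X ->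
  ric (X + H) = ric X + ((acl X)^T *m H + H *m acl X) + H *m N *m N^T *m H.
Proof.
move=> Xs; rewrite /ric /acl [(A + _)^T]linearD /= !trmx_mul trmxK Xs.
rewrite !(mulmxDl, mulmxDr) !mulmxA.
by apply/matrixP => i j; rewrite !addmxE; ring.
Qed.

Lemma tr_ric X : Q^T = Q -> X^T = X -> (ric X)^T = ric X.
Proof.
move=> Qs Xs; rewrite /ric !linearD /= !trmx_mul !trmxK Xs Qs !mulmxA.
by rewrite (addrC (X *m A)).
Qed.

Lemma quad_gramE (H : 'M[F]_n) : H^T = H ->
  H *m N *m N^T *m H = (N^T *m H)^T *m (N^T *m H).
Proof. by move=> Hs; rewrite trmx_mul trmxK Hs !mulmxA. Qed.

(** The standing assumptions: [P] is a supersolution, strict in the directions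
that [Dlt] sees, and it stabilizes up to the correction [B Dlt]. *)
Variables (P : 'M[F]_n) (B : 'M[F]_(n, p)) (Dlt : 'M[F]_(p, n)) (c : F).
Hypothesis Qpsd : psdmx Q.
Hypothesis Ppsd : psdmx P.
Hypothesis c0 : 0 < c.
Hypothesis Psuper : psdmx (- ric P - c *: (Dlt^T *m Dlt)).
Hypothesis Phurwitz : hurwitz (acl P + B *m Dlt).

Lemma supersolution_qf v : c * sqn (cplxmx Dlt *m v) <= - qf (ric P) v.
Proof.
have /psdmx_qf[_ /(_ v)] := Psuper.
by rewrite qfD !qfN qfZ qf_gram; lra.
Qed.

(** With [Z = P - X], the Lyapunov operator of [acl X] at [Z] equals
[ric P - ric X - Z N N^T Z].  At an eigenvector for an eigenvalue with
nonnegative real part its form is nonnegative, while each of the three terms is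
nonpositive; so all vanish, and [acl X] agrees there with the Hurwitz matrix
[acl P + B Dlt]. *)
Lemma subsolution_hurwitz X : X^T = X -> psdmx (P - X) -> psdmx (ric X) ->
  hurwitz (acl X).
Proof.
move=> Xs PX ricX z /eigenvalue_colP[v v0 Xv].
rewrite ltNge; apply/negP => z0.
have Zs : (P - X)^T = P - X by exact: PX.1.
have PE : P = X + (P - X) by rewrite addrC subrK.
have := supersolution_qf v.
rewrite [in ric P]PE ric_taylor // quad_gramE // qfD qf_gram qfD.
have -> : qf ((acl X)^T *m (P - X) + (P - X) *m acl X) v
    = 2 * (complex.Re z * qf (P - X) v).
  by rewrite qf_lyap // Xv rdot_selfadj_scale.
have /psdmx_qf[_ /(_ v) h1] := PX; have /psdmx_qf[_ /(_ v) h2] := ricX.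
have h3 := mulr_ge0 z0 h1.
have h4 := sqn_ge0 (cplxmx (N^T *m (P - X)) *m v).
have h5 := mulr_ge0 (ltW c0) (sqn_ge0 (cplxmx Dlt *m v)).
move=> /(squeeze0 h5 h4 h2 h3)[/eqP + /eqP].
rewrite mulf_eq0 gt_eqF //= !sqn_eq0 => /eqP D0 /eqP N0.
have : complex.Re z < 0.
  apply: Phurwitz; apply/eigenvalue_colP; exists v => //.
  have -> : acl P + B *m Dlt = acl X + N *m (N^T *m (P - X)) + B *m Dlt.
    by rewrite {1}PE /acl mulmxDr -!mulmxA !addrA.
  rewrite cplxmxD [cplxmx (acl X + _)]cplxmxD !mulmxDl Xv.
  rewrite (cplxmxM N) (cplxmxM B) -!mulmxA.
  by rewrite N0 D0 !mulmx0 !addr0.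
by rewrite ltNge z0.
Qed.

(** This is [subsolution_hurwitz] at [X = 0], where [ric 0 = Q]. *)
Lemma supersolution_hurwitz : hurwitz A.
Proof.
have := @subsolution_hurwitz 0; rewrite /acl mulmx0 addr0; apply.
- by rewrite trmx0.
- by rewrite subr0.
- by rewrite /ric !mulmx0 mul0mx !addr0 add0r.
Qed.

Definition subsolution (X : 'M[F]_n) : Prop :=
  [/\ X^T = X, psdmx (P - X) & psdmx (ric X)].

(** The Newton increment [H] solves the Lyapunov equation of [acl X] with right
side [- ric X], so [H >= 0] and [ric (X + H) = H N N^T H >= 0].  Convexity of
[ric] keeps the iterate below [P]: the Lyapunov operator at [P - X - H] is
[ric P - (P - X) N N^T (P - X)], which is nonpositive. *)
Lemma newton_step X : subsolution X -> exists Y, [/\ subsolution Y, psdmx (Y - X)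
  & ric Y = (Y - X) *m N *m N^T *m (Y - X)].
Proof.
move=> [Xs PX ricX].
have hX := subsolution_hurwitz Xs PX ricX.
have Rs : (- ric X)^T = - ric X by rewrite linearN /= tr_ric // Qpsd.1.
have [H Hs HE] := lyapunov_solution hX Rs.
have YX : X + H - X = H by rewrite addrC addKr.
have ricY : ric (X + H) = H *m N *m N^T *m H.
  by rewrite ric_taylor // HE subrr add0r.
have Hpsd : psdmx H by apply: (lyapunov_psd hX) => //; rewrite HE opprK.
exists (X + H); rewrite YX; split => //; split.
- by rewrite linearD /= Xs Hs.
- pose Z := P - X.
  have Zs : Z^T = Z by exact: PX.1.
  have ZH : P - (X + H) = Z - H by rewrite /Z opprD addrA.
  have PE : P = X + Z by rewrite /Z addrC subrK.
  rewrite ZH; apply: (lyapunov_psd hX); first by rewrite linearB /= Zs Hs.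
  have -> : - ((acl X)^T *m (Z - H) + (Z - H) *m acl X) =
     (- ric P - c *: (Dlt^T *m Dlt)) + c *: (Dlt^T *m Dlt) + Z *m N *m N^T *m Z.
    rewrite subrK [in ric P]PE ric_taylor // mulmxBr mulmxBl.
    apply/matrixP => i j; move/matrixP/(_ i j): HE.
    rewrite !(addmxE, oppmxE); lra.
  apply: psdmxD; last by rewrite quad_gramE //; exact: psdmx_gram.
  apply: psdmxD => //; apply: psdmxZ; [exact: ltW | exact: psdmx_gram].
- by rewrite ricY quad_gramE //; exact: psdmx_gram.
Qed.

(** The limit [L] of the Newton iterates satisfies [ric L = 0] because the
residual of an iterate is quadratic in the last increment, which tends to
[0]. *)
Lemma stabilizing_solution_exists :
  exists X, [/\ psdmx X, ric X = 0 & hurwitz (acl X)].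
Proof.
have step X : exists Y, subsolution X -> [/\ subsolution Y, psdmx (Y - X)
    & ric Y = (Y - X) *m N *m N^T *m (Y - X)].
  have [hX|hX] := pselect (subsolution X); last by exists 0.
  by have [Y hY] := newton_step hX; exists Y.
have [f fP] := choice step.
pose X_ i := iter i f 0.
have X_P i : subsolution (X_ i).
  elim: i => [|i IH]; last by have [] := fP _ IH.
  split; first by rewrite trmx0.
    by rewrite subr0.
  by rewrite /ric !mulmx0 mul0mx !addr0 add0r.
have [L XL] : exists L, mxcvg X_ L.
  apply: (@mxcvg_monotone _ _ _ P) => i; first by case: (X_P i).
    by have [] := fP _ (X_P i).
  by case: (X_P i).
have XSL : mxcvg (fun i => X_ i.+1) L.
  by move=> a b; have := XL a b; rewrite -(cvg_shiftS (fun i => X_ i a b)).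
have cst q r (M : 'M[F]_(q, r)) : mxcvg (fun=> M) M by exact: mxcvg_cst.
have ricL : mxcvg (fun i => ric (X_ i.+1)) (ric L).
  have AX := mxcvgD (mxcvgM (cst _ _ A^T) XSL) (mxcvgM XSL (cst _ _ A)).
  have XNX := mxcvgM (mxcvgM (mxcvgM XSL (cst _ _ N)) (cst _ _ N^T)) XSL.
  exact: mxcvgD (mxcvgD AX (cst _ _ Q)) XNX.
have ric0 : mxcvg (fun i => ric (X_ i.+1)) 0.
  have -> : 0 = (L - L) *m N *m N^T *m (L - L) by rewrite subrr mulmx0.
  under eq_fun do rewrite (let: And3 _ _ e := fP _ (X_P _) in e).
  have XB := mxcvgB XSL XL.
  exact: mxcvgM (mxcvgM (mxcvgM XB (cst _ _ N)) (cst _ _ N^T)) XB.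
have L0 : ric L = 0 by exact: mxcvg_unique ricL ric0.
have Ls : L^T = L.
  apply: (mxcvg_unique (mxcvg_tr XL)) => a b.
  under eq_fun do rewrite (let: And3 e _ _ := X_P _ in e); exact: XL.
have PL : psdmx (P - L).
  apply: (@mxcvg_psd _ _ (fun i => P - X_ i)) => [i|]; first by case: (X_P i).
  exact: mxcvgB.
have ricLpsd : psdmx (ric L) by rewrite L0; exact: psdmx0.
exists L; split; [|exact: L0|exact: subsolution_hurwitz Ls PL ricLpsd].
apply: (lyapunov_psd supersolution_hurwitz) => //.
have -> : - (A^T *m L + L *m A) = Q + (N^T *m L)^T *m (N^T *m L).
  rewrite -quad_gramE //; apply/matrixP => i j; move/matrixP/(_ i j): L0.
  rewrite [X in _ = X -> _]mxE /ric !(addmxE, oppmxE); lra.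
by apply: psdmxD => //; exact: psdmx_gram.
Qed.

(** The bounded real inequality with a uniform margin.  The identity [ident]
leaves the loss [|r|^2 - x^* (ric P) x >= |r|^2 + c |Dlt x|^2], and the
resolvent bound for [acl P + B Dlt] shows that this loss controls first [x] and
then [u = r + N^T P x]. *)
Lemma strict_gain_bound : exists2 e : F, 0 < e <= 1 &
  forall (w : F) (x : 'cV[C]_n) (u : 'cV[C]_k),
    (0 +i* w) *: x = cplxmx A *m x + cplxmx N *m u ->
    qf Q x <= (1 - e) * sqn u.
Proof.
have [c1 c1p h1] := resolvent_bound Phurwitz.
have [c2 c2p h2] := sqn_mulmx_bounded (cplxmx N).
have [c3 c3p h3] := sqn_mulmx_bounded (cplxmx B).
have [c4 c4p h4] := sqn_mulmx_bounded (cplxmx (N^T *m P)).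
have b41 := mulr_gt0 c4p c1p.
have b412 := mulr_gt0 b41 c2p; have b413 := mulr_gt0 b41 c3p.
have [q q0 qc] : exists2 q, 0 < q & q * c = 4 * (c4 * c1 * c3).
  exists (4 * (c4 * c1 * c3) / c); first by rewrite divr_gt0 // mulr_gt0.
  by rewrite divfK // gt_eqF.
pose b := 2 + 4 * (c4 * c1 * c2) + q.
have b0 : 1 < b by rewrite /b; lra.
exists b^-1 => [|w x u E].
  by rewrite invr_gt0 invf_le1 ?(ltW b0) //; lra.
have Ps := Ppsd.1.
pose y := cplxmx (N^T *m P) *m x.
pose r := u - y.
pose dx := cplxmx Dlt *m x.
have Wx := supersolution_qf x; rewrite -/dx in Wx.
have ident : qf Q x = sqn u - sqn r + qf (ric P) x.
  have E1 : qf (ric P) x =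
      2 * rdot (cplxmx P *m x) (cplxmx A *m x) + qf Q x + sqn y.
    by rewrite /ric quad_gramE // qfD qf_gram qfD qf_lyap.
  have E2 : rdot (cplxmx P *m x) (cplxmx A *m x) = - rdot y u.
    have -> : cplxmx A *m x = (0 +i* w) *: x - cplxmx N *m u.
      by rewrite E addrK.
    rewrite rdotDr rdotNr rdot_imag ?cplxmx_adj ?Ps // add0r; congr (- _).
    by rewrite rdot_adj cplxmx_adj mulmxA -cplxmxM.
  rewrite E1 E2 /r /sqn rdotDl !rdotDr !(rdotNl, rdotNr) (rdotC u y).
  by move: (rdot u u) (rdot y y) (rdot y u) (qf Q x) => *; ring.
have xb : sqn x <= c1 * (2 * (c2 * sqn r) + 2 * (c3 * sqn dx)).
  apply: (le_trans (h1 w x (cplxmx N *m r - cplxmx B *m dx) _)).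
    rewrite E /acl /r /y /dx !cplxmxD !cplxmxM !mulmxDl mulmxBr -!mulmxA.
    apply/matrixP => i j; rewrite !(addmxE, oppmxE); ring.
  rewrite ler_wpM2l ?(ltW c1p) //; apply: le_trans (sqnD _ _) _.
  by rewrite sqnN lerD // ler_wpM2l.
have ub : sqn u <= b * (sqn r + c * sqn dx).
  have : sqn u <= 2 * sqn r + 2 * sqn y.
    by have := sqnD r y; rewrite /r subrK.
  have y1 := h4 x; rewrite -/y in y1.
  have y2 := ler_wpM2l (ltW c4p) xb.
  have hr := sqn_ge0 r; have hd := sqn_ge0 dx.
  have cd : 0 <= c * sqn dx by rewrite mulr_ge0 // ltW.
  have e1 : q * (c * sqn dx) = 4 * (c4 * c1 * c3) * sqn dx.
    by rewrite [LHS]mulrA qc.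
  have := mulr_ge0 (ltW b412) cd; have := mulr_ge0 (ltW q0) hr.
  by rewrite /b; lra.
have : b^-1 * sqn u <= sqn r + c * sqn dx.
  by rewrite mulrC ler_pdivrMr ?[_ * b]mulrC //; lra.
rewrite ident; lra.
Qed.

End Riccati.

(** * Operator norm, largest singular value and coercivity *)

Section Norms.
Local Open Scope complex_scope.
Local Open Scope classical_set_scope.
Local Open Scope sesquilinear_scope.
Variable F : realType.
Local Notation C := F[i].

Lemma pdmx_psd n (R : 'M[F]_n) : pdmx R -> psdmx R.
Proof.
move=> [Rs R0]; split=> // v; have [->|v0] := eqVneq v 0.
  by rewrite mulmx0 mxE.
exact: ltW (R0 _ v0).
Qed.

Lemma pdmx_unit n (R : 'M[F]_n) : pdmx R -> R \in unitmx.
Proof.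
move=> [Rs R0]; rewrite unitmxE unitfE; apply/negP => /det0P[v v0 vR].
by have := R0 v^T; rewrite trmx_eq0 trmxK vR mul0mx mxE ltxx => /(_ v0).
Qed.

(** Expanding the form of [R] at [v - k^-1 R^-1 v], where [k] bounds the form
of [R^-1], gives [v^* R v >= k^-1 |v|^2] without any compactness. *)
Lemma pdmx_coercive n (R : 'M[F]_n) : pdmx R ->
  exists2 k : F, 0 < k & psdmx (R - k%:M).
Proof.
move=> Rpd; have Ru := pdmx_unit Rpd; have Rs := Rpd.1.
have /psdmx_qf[_ R0] := pdmx_psd Rpd.
have [c c0 hc] := sqn_mulmx_bounded (cplxmx (invmx R)).
pose k := (c + 1) / 2; have k0 : 0 < k by rewrite /k; lra.
exists k^-1; first by rewrite invr_gt0.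
apply/psdmx_qf; split=> [|v]; first by rewrite linearB /= Rs tr_scalar_mx.
rewrite qfD qfN qf1.
pose y := cplxmx (invmx R) *m v.
have Ry : cplxmx R *m y = v.
  by rewrite /y mulmxA -cplxmxM mulmxV // /cplxmx map_mx1 mul1mx.
have yv : rdot y v <= k * sqn v.
  have := rdot_young y v ltr01; have := hc v; rewrite invr1 -/y /k; lra.
have := R0 (v - (k^-1)%:C *: y).
rewrite /qf mulmxBr -scalemxAr Ry rdotDl !rdotDr.
rewrite !(rdotNl, rdotNr, rdotZl, rdotZr).
have -> : rdot y (cplxmx R *m v) = sqn v.
  by rewrite rdot_adj cplxmx_adj Rs Ry.
rewrite -/(sqn v) => h.
have : k^-1 * rdot y v <= sqn v.
  by rewrite -(ler_pM2l k0) mulVKf ?gt_eqF.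
have ki : 0 <= k^-1 by rewrite invr_ge0 ltW.
move=> /(ler_wpM2l ki); lra.
Qed.

Lemma norm2_sqr n (v : 'cV[F]_n) : norm2 v ^+ 2 = sqn (cplxmx v).
Proof.
rewrite /norm2 sqr_sqrtr ?sumr_ge0 // => [|i _]; last exact: sqr_ge0.
by rewrite sqnE; apply: eq_bigr => i _; rewrite mxE /sqmod /= expr0n addr0.
Qed.

Lemma norm2_ge0 n (v : 'cV[F]_n) : 0 <= norm2 v.
Proof. exact: sqrtr_ge0. Qed.

Lemma norm2Z n a (v : 'cV[F]_n) : norm2 (a *: v) = `|a| * norm2 v.
Proof.
apply/eqP; rewrite -(@eqrXn2 _ 2) ?mulr_ge0 ?norm2_ge0 //.
rewrite exprMn !norm2_sqr cplxmxZ /sqn rdotZl rdotZr mulrA -expr2.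
by rewrite real_normK ?num_real.
Qed.

Lemma opnorm_bound p q (M : 'M[F]_(p, q)) v :
  norm2 (M *m v) <= opnorm M * norm2 v.
Proof.
have [c c0 hc] := sqn_mulmx_bounded (cplxmx M).
have bnd (w : 'cV[F]_q) : norm2 w <= 1 -> norm2 (M *m w) <= opnorm M.
  move=> w1; apply: ub_le_sup; last by exists w.
  exists (Num.sqrt c) => _ [u u1 <-].
  rewrite -(@ler_pXn2r _ 2) ?nnegrE ?norm2_ge0 ?sqrtr_ge0 //.
  rewrite norm2_sqr sqr_sqrtr ?(ltW c0) // cplxmxM; apply: le_trans (hc _) _.
  rewrite -norm2_sqr -[leRHS]mulr1 ler_wpM2l ?(ltW c0) //.
  by rewrite expr_le1 ?norm2_ge0.
have [v0|v0] := eqVneq (norm2 v) 0.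
  rewrite v0 mulr0 -(@ler_pXn2r _ 2) ?nnegrE ?norm2_ge0 //.
  rewrite expr0n /= norm2_sqr cplxmxM; apply: le_trans (hc _) _.
  by rewrite -norm2_sqr v0 expr0n /= mulr0.
have vp : 0 < norm2 v by rewrite lt_neqAle eq_sym v0 norm2_ge0.
have := bnd ((norm2 v)^-1 *: v).
rewrite -scalemxAr !norm2Z ger0_norm ?invr_ge0 ?norm2_ge0 // mulVf //.
by move=> /(_ (lexx _)); rewrite mulrC ler_pdivrMr.
Qed.

Lemma opnorm_psd n (R : 'M[F]_n) : R^T = R -> 0 < opnorm R ->
  psdmx ((opnorm R)%:M - R).
Proof.
move=> Rs a0; split=> [|v]; first by rewrite linearB /= tr_scalar_mx Rs.
set a := opnorm R in a0 *.
have -> : (v^T *m (a%:M - R) *m v) 0 0 = qf (a%:M - R) (cplxmx v).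
  by rewrite /qf -cplxmxM rdot_cplx mulmxA.
rewrite qfD qfN qf1 /qf.
have := rdot_young (cplxmx v) (cplxmx R *m cplxmx v) a0.
rewrite -cplxmxM -[sqn (cplxmx (R *m v))]norm2_sqr.
have : norm2 (R *m v) ^+ 2 <= a * a * sqn (cplxmx v).
  rewrite -norm2_sqr -expr2 -exprMn.
  rewrite ler_pXn2r ?nnegrE ?mulr_ge0 ?norm2_ge0 ?(ltW a0) //.
  exact: opnorm_bound.
have ai : 0 <= a^-1 by rewrite invr_ge0 ltW.
move=> /(ler_wpM2l ai); rewrite -mulrA mulKf ?gt_eqF //; lra.
Qed.

(** When there is no singular value, [sup set0 = 0], whence the hypothesis
[0 <= g]. *)
Lemma sigma_max_bound p q (M : 'M[C]_(p, q)) (g : F) : 0 <= g ->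
  (forall v, sqn (M *m v) <= g ^+ 2 * sqn v) -> sigma_max M <= g.
Proof.
move=> g0 hM; rewrite /sigma_max.
set S := [set s : F | _].
have Sg s : S s -> s <= g.
  move=> [s0 /eigenvalue_colP[v v0 Mv]].
  rewrite -(@ler_pXn2r _ 2) ?nnegrE //.
  have vp : 0 < sqn v by rewrite sqn_gt0.
  rewrite -(ler_pM2r vp); apply: le_trans (hM v).
  by rewrite {2}/sqn rdot_adj mulmxA Mv rdotC rdotZr.
have [->|/set0P[s Ss]] := eqVneq S set0; first by rewrite sup0.
by apply: ge_sup; [exists s | exact: Sg].
Qed.

(** An inequality suffices, and it holds both for a genuine square root and for
the default value [0], which settles both cases of the definition at once. *)
Lemma psd_sqrt_qf n (Q : 'M[F]_n) x : psdmx Q ->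
  sqn (cplxmx (psd_sqrt Q) *m x) <= qf Q x.
Proof.
move=> /psdmx_qf[_ Q0]; rewrite /psd_sqrt.
case: xgetP => [S _ [[Ss _] <-]|_]; last first.
  by rewrite /cplxmx map_mx0 mul0mx sqn0.
by rewrite -{2}Ss qf_gram.
Qed.

End Norms.

(** * One policy update *)

Section Step.
Local Open Scope complex_scope.
Variables (F : realType) (m d l n : nat).
Variables (A : 'M[F]_m) (B : 'M[F]_(m, d)) (C : 'M[F]_(l, m)).
Variables (D : 'M[F]_(m, n)) (R : 'M[F]_d) (gamma : F).
Hypothesis Rpd : pdmx R.
Hypothesis gamma0 : 0 < gamma.
Implicit Types (K : 'M[F]_(d, m)) (P : 'M[F]_m).

(** Scaling the disturbance by [gamma^-1] turns the bound [gamma] into 1. *)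
Let N : 'M[F]_(m, n) := gamma^-1 *: D.
Let Qk K : 'M[F]_m := C^T *m C + K^T *m R *m K.

Lemma scaled_input_gram : N *m N^T = gamma ^- 2 *: (D *m D^T).
Proof.
by rewrite /N linearZ /= -scalemxAl -scalemxAr scalerA -invfM -expr2.
Qed.

Lemma stabilizing_solutionE K P : stabilizing_solution A B C D R gamma K P <->
  [/\ psdmx P, ric (A - B *m K) (Qk K) N P = 0
    & hurwitz (acl (A - B *m K) N P)].
Proof.
rewrite /stabilizing_solution /ric /acl /Qk -(mulmxA P N) scaled_input_gram.
by rewrite -scalemxAr -!scalemxAl !mulmxA !addrA.
Qed.

Lemma Qk_psd K : psdmx (Qk K).
Proof.
apply: psdmxD; first exact: psdmx_gram.
exact/psdmx_congr/pdmx_psd.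
Qed.

(** Completing the square in [K]: the Riccati residual is quadratic in the
gain, with gradient [R K - B^T P] and Hessian [R]. *)
Lemma ric_step K P Dlt : P^T = P ->
  ric (A - B *m (K + Dlt)) (Qk (K + Dlt)) N P =
  ric (A - B *m K) (Qk K) N P + Dlt^T *m (R *m K - B^T *m P)
    + (R *m K - B^T *m P)^T *m Dlt + Dlt^T *m R *m Dlt.
Proof.
move=> Ps; have Rs := Rpd.1.
rewrite /ric /Qk !mxtrB !mxtrD !trmx_mul !mxtrD trmxK Ps Rs.
rewrite !(mulmxDl, mulmxDr, mulmxN, mulNmx, opprD) !mulmxA.
apply/matrixP => i j; rewrite !(addmxE, oppmxE); ring.
Qed.

Lemma strict_bound_feasible K e : 0 < e <= 1 -> hurwitz (A - B *m K) ->
  (forall (w : F) (x : 'cV[F[i]]_m) (u : 'cV[F[i]]_n),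
    (0 +i* w) *: x = cplxmx (A - B *m K) *m x + cplxmx N *m u ->
    qf (Qk K) x <= (1 - e) * sqn u) ->
  feasible A B C D R gamma K.
Proof.
move=> /andP[e0 e1] hA hb; split => //.
pose g := Num.sqrt (1 - e) * gamma.
have g0 : 0 <= g by rewrite mulr_ge0 ?sqrtr_ge0 ?ltW.
have g2 : g ^+ 2 = (1 - e) * gamma ^+ 2.
  by rewrite exprMn sqr_sqrtr // subr_ge0.
have ggamma : g < gamma.
  rewrite -(@ltr_pXn2r _ 2) ?nnegrE ?(ltW gamma0) // g2.
  by rewrite gtr_pMl ?exprn_gt0 //; lra.
apply: (@le_lt_trans _ _ g%:E); last by rewrite lte_fin.
apply: ge_ereal_sup => _ [w _ <-]; rewrite lee_fin.
apply: sigma_max_bound => // v; rewrite /transfer -mulmxA -mulmxA -/(Qk K).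
set x := invmx _ *m _.
apply: (@le_trans _ _ (qf (Qk K) x)); first exact: psd_sqrt_qf (Qk_psd K).
have Iu : (0 +i* w)%:M - cplxmx (A - B *m K) \in unitmx.
  rewrite unitmxE unitfE; apply/negP => /det0P[y y0 yE].
  have : complex.Re (0 +i* w) < 0; last by rewrite /= ltxx.
  apply: hA; apply/eigenvalueP; exists y => //.
  by apply/eqP; rewrite eq_sym -subr_eq0 -mul_mx_scalar -mulmxBr yE.
have xE : (0 +i* w) *: x =
    cplxmx (A - B *m K) *m x + cplxmx N *m (gamma%:C *: v).
  rewrite /N cplxmxZ -scalemxAl -scalemxAr scalerA -rmorphM /= mulVf ?gt_eqF //.
  rewrite scale1r; have := mulKVmx Iu (cplxmx D *m v).
  by rewrite -/x mulmxBl mul_scalar_mx => <-; rewrite addrC subrK.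
apply: (le_trans (hb _ _ _ xE)).
by rewrite g2 expr2 {1}/sqn rdotZl rdotZr -!mulrA.
Qed.

(** Both updates at once: [T = 1] is the natural policy gradient and [T = R]
the Gauss-Newton step.  Substituting the relation between the gradient and
[K' - K] in [ric_step] gives
[- ric P = (K' - K)^T (eta^-1 T - R) (K' - K)]. *)
Lemma step_feasible K K' P (T : 'M[F]_d) (eta c : F) :
  stabilizing_solution A B C D R gamma K P -> 0 < eta -> 0 < c ->
  T^T = T -> R *m K - B^T *m P = - (2 * eta)^-1 *: (T *m (K' - K)) ->
  psdmx (eta^-1 *: T - R - c%:M) ->
  feasible A B C D R gamma K' /\ hurwitz (A - B *m K') /\
  exists P', stabilizing_solution A B C D R gamma K' P'.
Proof.
move=> /stabilizing_solutionE[Ppsd P0 Ph] eta0 c0 Ts E Tpsd.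
pose Dlt := K' - K.
have K'E : K' = K + Dlt by rewrite addrC subrK.
rewrite -/Dlt in E; clearbody Dlt.
have super : psdmx (- ric (A - B *m K') (Qk K') N P - c *: (Dlt^T *m Dlt)).
  have -> : - ric (A - B *m K') (Qk K') N P - c *: (Dlt^T *m Dlt)
     = Dlt^T *m (eta^-1 *: T - R - c%:M) *m Dlt.
    rewrite {1 2}K'E ric_step ?Ppsd.1 // P0 add0r E.
    rewrite mxtrZ trmx_mul Ts -!scalemxAr -!scalemxAl.
    rewrite !(mulmxDl, mulmxDr, mulmxN, mulNmx) -!scalemxAr -!scalemxAl.
    rewrite mul_mx_scalar -scalemxAl !mulmxA.
    apply/matrixP => i j; rewrite !(addmxE, oppmxE, scalemxE) invfM; lra.
  exact: psdmx_congr.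
have hur : hurwitz (acl (A - B *m K') N P + B *m Dlt).
  have -> : acl (A - B *m K') N P + B *m Dlt = acl (A - B *m K) N P.
    rewrite /acl K'E mulmxDr.
    apply/matrixP => i j; rewrite !(addmxE, oppmxE); ring.
  by [].
have hA := supersolution_hurwitz (Qk_psd K') Ppsd c0 super hur.
split; last split => //.
  have [e e01 he] := strict_gain_bound Ppsd c0 super hur.
  exact: strict_bound_feasible e01 hA he.
have [X [X1 X2 X3]] :=
  stabilizing_solution_exists (Qk_psd K') Ppsd c0 super hur.
by exists X; apply/stabilizing_solutionE.
Qed.

End Step.

Theorem theoremA6 (F : realType) (m d l n : nat)
    (A : 'M[F]_m) (B : 'M[F]_(m, d)) (C : 'M[F]_(l, m)) (D : 'M[F]_(m, n))
    (E : 'M[F]_(l, d)) (R : 'M[F]_d) (gamma : F)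
    (hR : pdmx R)
    (hE : E^T *m row_mx C E = row_mx 0 R)
    (hgamma : 0 < gamma)
    (K : 'M[F]_(d, m))
    (hK : feasible A B C D R gamma K)
    (P : 'M[F]_m)
    (hP : stabilizing_solution A B C D R gamma K P)
    (eta : F)
    (heta : 0 < eta)
    (K' : 'M[F]_(d, m))
    (hK' : (eta <= 1 / (2 * opnorm R) /\
            K' = K - (2 * eta) *: (R *m K - B^T *m P))
        \/ (eta <= 1 / 2 /\
            K' = K - (2 * eta) *: (K - invmx R *m B^T *m P))) :
  feasible A B C D R gamma K' /\
  (hurwitz (A - B *m K') /\
   exists P' : 'M[F]_m, stabilizing_solution A B C D R gamma K' P').
Proof.
have eta2 : 2 * eta != 0 by rewrite mulf_neq0 ?pnatr_eq0 ?gt_eqF.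
have ei0 : 0 < eta^-1 by rewrite invr_gt0.
case: hK' => [[eta_le K'E]|[eta_le K'E]].
  (* Otherwise [1 / (2 * opnorm R) <= 0]: in dimension 0 the norm is 0, and so
     is its inverse. *)
  have a0 : 0 < opnorm R.
    have := lt_le_trans heta eta_le; rewrite mul1r invr_gt0 pmulr_rgt0 //.
  (* [T = 1]; with [c = 1 / (2 eta)], half of [eta^-1] absorbs [R], whose form
     is at most [opnorm R <= 1 / (2 eta)] times the squared norm. *)
  apply: (@step_feasible _ _ _ _ _ A B C D R gamma hR hgamma K K' P 1%:M eta
    (eta^-1 / 2)) => //.
  - by rewrite divr_gt0.
  - by rewrite trmx1.
  - rewrite K'E mul1mx addrAC subrr sub0r scalerN scaleNr opprK scalerA.
    by rewrite mulVf ?scale1r.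
  have aeta : opnorm R <= eta^-1 / 2.
    rewrite ler_pdivlMr // in eta_le; last by rewrite mulr_gt0.
    by rewrite ler_pdivlMr // -(ler_pM2l heta) divff ?gt_eqF // [_ * 2]mulrC.
  have -> : eta^-1 *: 1%:M - R - (eta^-1 / 2)%:M
      = ((opnorm R)%:M - R) + (eta^-1 / 2 - opnorm R)%:M.
    apply/matrixP => i j; rewrite !(addmxE, oppmxE, scalemxE) !mxE.
    by case: eqP; rewrite ?mulr1n ?mulr0n; lra.
  apply: psdmxD; first exact: opnorm_psd hR.1 a0.
  rewrite -scalemx1 -[1%:M]mulmx1 -[X in X *m _]trmx1.
  by apply: psdmxZ; [rewrite subr_ge0 | exact: psdmx_gram].
(* [T = R]; here [eta^-1 - 1 >= 1], so [(eta^-1 - 1) R >= R >= k]. *)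
have [k k0 Rk] := pdmx_coercive hR.
apply: (@step_feasible _ _ _ _ _ A B C D R gamma hR hgamma K K' P R eta k) => //.
- exact: hR.1.
- rewrite K'E addrAC subrr sub0r mulmxN -scalemxAr scalerN scaleNr opprK scalerA.
  by rewrite mulVf // scale1r mulmxBr !mulmxA mulmxV ?pdmx_unit // mul1mx.
have -> : eta^-1 *: R - R - k%:M = (R - k%:M) + (eta^-1 - 2) *: R.
  apply/matrixP => i j; rewrite !(addmxE, oppmxE, scalemxE); ring.
apply: psdmxD => //; apply: psdmxZ (pdmx_psd hR); rewrite subr_ge0.
by rewrite -[2]invrK lef_pV2 ?posrE ?invr_gt0 //; rewrite mul1r in eta_le.
Qed.
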